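(* Given a positive integer $r$, let $c\ge e/36$ be a constant. Suppose that $G$ is a graph on $n>18cr^3$ vertices, having at most $cn$ edges. Then $G$ is $r$-EKR.
   Context: All graphs are finite and simple. For a graph $G$, $\mathcal{I}^r(G)$ denotes the family of independent sets of $G$ of size exactly $r$, and for a vertex $v$, $s_r(v)$ denotes the number of members of $\mathcal{I}^r(G)$ containing $v$. A family of sets is intersecting if every two of its members intersect. $G$ is called $r$-EKR if, letting $\mathcal{F}\subseteq \mathcal{I}^r(G)$ be an intersecting subfamily of maximum size, some vertex $v$ satisfies $s_r(v)=|\mathcal{F}|$. *)

(* Defs.v *)
From mathcomp Require Import all_boot all_order all_algebra.

Set Implicit Arguments.
Unset Strict Implicit.
Unset Printing Implicit Defensive.

Record sgraph := SGraph {
  vertex :> finType;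
  adj : rel vertex;
  adj_sym : symmetric adj;
  adj_irrefl : irreflexive adj
}.

Definition edges (G : sgraph) : {set {set G}} :=
  [set [set p.1; p.2] | p in [set p : G * G | adj p.1 p.2]].

Definition independent (G : sgraph) (A : {set G}) : bool :=
  [forall x in A, forall y in A, ~~ adj x y].

Definition indep_sets (G : sgraph) (r : nat) : {set {set G}} :=
  [set A : {set G} | independent A & #|A| == r].

Definition star_size (G : sgraph) (r : nat) (v : G) : nat :=
  #|[set A in indep_sets G r | v \in A]|.

(* A = B is allowed, so a member of an intersecting family is nonempty; for
   families of r-sets with 0 < r this agrees with requiring it only of pairs
   of distinct members. *)
Definition intersecting (T : finType) (F : {set {set T}}) : Prop :=
  forall A B : {set T}, A \in F -> B \in F -> A :&: B != set0.

Definition max_intersecting (G : sgraph) (r : nat) (F : {set {set G}}) : Prop :=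
  [/\ F \subset indep_sets G r, intersecting F &
      forall F' : {set {set G}},
        F' \subset indep_sets G r -> intersecting F' -> #|F'| <= #|F|].

Definition EKR (r : nat) (G : sgraph) : Prop :=
  forall F : {set {set G}},
    max_intersecting r F -> exists v : G, star_size r v = #|F|.

(* Main.v *)
Require Import Defs.
From mathcomp Require Import all_boot all_order all_algebra.
From mathcomp Require Import reals sequences exp.
From mathcomp Require Import lra.

(** Let [D] be the number of [r]-sets containing a fixed pair of vertices. An
    intersecting family that is not contained in a star has at most [r^2 D]
    members: each of them meets a fixed member [A] in some [x], and also meets,
    in some [y <> x], a member avoiding [x]. On the other hand every dependent
    [r]-set contains an edge, so the average star size is at least
    [(r / n) (C(n, r) - m D)], where [m] is the number of edges. Since
    [n (n - 1) D = r (r - 1) C(n, r)], the hypothesis on [n] makes this average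
    at least [r^2 D] when [r >= 2]. *)

Set Implicit Arguments.
Unset Strict Implicit.
Unset Printing Implicit Defensive.

Import Order.TTheory GRing.Theory Num.Theory.

Lemma leq_card_bigcup (I U : finType) (P : pred I) (E : I -> {set U}) :
  #|\bigcup_(i | P i) E i| <= \sum_(i | P i) #|E i|.
Proof.
apply: (big_ind2 (fun (A : {set U}) m => #|A| <= m)) => [|A m B p Am Bp|//].
  by rewrite cards0.
by apply: leq_trans (leq_card_setU A B) _; rewrite leq_add.
Qed.

(** The map [B :|: _] is a bijection from the [k]-subsets of the complement of [B] onto these
    supersets; its inverse removes [B]. *)
Lemma card_supersets (T : finType) (B : {set T}) (k : nat) :
  #|[set A : {set T} | B \subset A & #|A| == #|B| + k]| = 'C(#|T| - #|B|, k).
Proof.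
have -> : #|T| - #|B| = #|~: B| by rewrite -(cardsC B) addKn.
rewrite -cards_draws; apply/esym.
rewrite -(@card_in_imset _ _ (fun A => B :|: A)) => [|A A'].
  apply: eq_card => A; rewrite inE; apply/imsetP/andP => [[C]|[sBA /eqP cA]].
    rewrite inE => /andP[sCB /eqP cC] ->; split; first exact: subsetUl.
    rewrite cardsU cC (_ : B :&: C = set0) ?cards0 ?subn0 //.
    by apply/eqP; rewrite setI_eq0 disjoint_sym disjoints_subset.
  exists (A :\: B); last by rewrite -[LHS](setID A B) (setIidPr sBA).
  by rewrite inE subsetDr /= cardsD (setIidPr sBA) cA addKn.
rewrite !inE => /andP[sA _] /andP[sA' _] /(congr1 (fun C => C :\: B)).
rewrite !setDUl setDv !set0U !setDE.
by rewrite (setIidPl sA) (setIidPl sA').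
Qed.

(** The absorption identity, applied twice. With [n = #|G|] it expresses [D] through the number of
    all [r]-sets, for [r = k.+2]. *)
Lemma bin_pair (n k : nat) :
  n * n.-1 * 'C(n.-2, k) = k.+2 * k.+1 * 'C(n, k.+2).
Proof.
rewrite -mulnA mul_bin_diag mulnCA mul_bin_diag.
by rewrite mulnA [k.+1 * _]mulnC.
Qed.

Lemma leq_card_intersecting_nonstar (T : finType) (k : nat)
    (F : {set {set T}}) :
    intersecting F -> (forall A, A \in F -> #|A| = k.+2) ->
    (forall x, exists2 B, B \in F & x \notin B) ->
  #|F| <= k.+2 ^ 2 * 'C(#|T|.-2, k).
Proof.
move=> Fint Fcard Fnonstar.
have [->|[A AF]] := set_0Vmem F; first by rewrite cards0.
(* [f x] is a member of [F] avoiding [x]; by [Fnonstar] the default [set0] is never taken. *)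
pose f x := odflt set0 [pick B in F | x \notin B].
have fP x : f x \in F /\ x \notin f x.
  rewrite /f; case: pickP => [B /andP[]//|none].
  by case: (Fnonstar x) => B BF xB; have := none B; rewrite /= BF xB.
pose sup x y := [set S : {set T} | [set x; y] \subset S & #|S| == k.+2].
have sFsup : F \subset \bigcup_(x in A) \bigcup_(y in f x) sup x y.
  apply/subsetP => S SF.
  have /set0Pn[x /setIP[xS xA]] := Fint _ _ SF AF.
  have [fxF _] := fP x.
  have /set0Pn[y /setIP[yS yf]] := Fint _ _ SF fxF.
  apply/bigcupP; exists x => //; apply/bigcupP; exists y => //.
  by rewrite inE subUset !sub1set xS yS Fcard //=.
apply: leq_trans (subset_leq_card sFsup) _.
apply: leq_trans (leq_card_bigcup _ _) _.
rewrite -mulnn -mulnA -{1}(Fcard _ AF) -sum_nat_const leq_sum // => x xA.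
apply: leq_trans (leq_card_bigcup _ _) _.
have [fxF xf] := fP x.
rewrite -(Fcard _ fxF) -sum_nat_const leq_sum // => y yf.
(* Here [y] lies in [f x], which avoids [x], so the two points are distinct. *)
have c2 : #|[set x; y]| = 2.
  rewrite cards2; suff -> : x != y by [].
  by apply: contraNneq xf => xy; rewrite {1}xy.
by have := card_supersets [set x; y] k; rewrite c2 subn2 => <-.
Qed.

Lemma card_edge (G : sgraph) (e : {set G}) : e \in edges G -> #|e| = 2.
Proof.
case/imsetP => -[x y]; rewrite inE /= => xy ->.
by rewrite cards2; case: eqP xy => // ->; rewrite adj_irrefl.
Qed.

(** Double counting of the pairs of a vertex and an independent [r]-set containing it. *)
Lemma sum_star_size (G : sgraph) (r : nat) :
  \sum_(v : G) star_size r v = r * #|indep_sets G r|.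
Proof.
rewrite mulnC -sum_nat_const.
under eq_bigr => v _ do rewrite /star_size -sum1dep_card big_mkcondr.
rewrite exchange_big /=; apply: eq_bigr => A.
rewrite inE => /andP[_ /eqP <-].
by rewrite -big_mkcond sum1_card.
Qed.

Lemma card_indep_sets_ge (G : sgraph) (k : nat) :
  'C(#|G|, k.+2) <= #|indep_sets G k.+2| + #|edges G| * 'C(#|G|.-2, k).
Proof.
pose sup (e : {set G}) := [set S : {set G} | e \subset S & #|S| == k.+2].
have csup e : e \in edges G -> #|sup e| = 'C(#|G|.-2, k).
  by move=> /card_edge e2; have := card_supersets e k; rewrite e2 subn2.
have sub : [set S : {set G} | #|S| == k.+2] \subset
    indep_sets G k.+2 :|: \bigcup_(e in edges G) sup e.
  apply/subsetP => S; rewrite !inE => cS; rewrite cS andbT.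
  case: (boolP (independent S)) => //= /forallPn[x]; rewrite negb_imply.
  case/andP=> xS /forallPn[y]; rewrite negb_imply negbK => /andP[yS xy].
  apply/bigcupP; exists [set x; y]; last by rewrite inE subUset !sub1set xS yS.
  by apply/imsetP; exists (x, y) => //; rewrite inE.
rewrite -card_draws.
apply: leq_trans (subset_leq_card sub) _.
apply: leq_trans (leq_card_setU _ _) _; rewrite leq_add2l.
apply: leq_trans (leq_card_bigcup _ _) _.
by rewrite (eq_bigr _ csup) sum_nat_const.
Qed.

(** The star of [v] competes with [F], since any two of its members share [v]. *)
Lemma star_size_le_max (G : sgraph) (r : nat) (F : {set {set G}}) (v : G) :
  max_intersecting r F -> star_size r v <= #|F|.
Proof.
move=> [_ _]; apply; first by apply/subsetP => A; rewrite inE => /andP[].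
move=> A B; rewrite !inE => /andP[_ vA] /andP[_ vB].
by apply/set0Pn; exists v; rewrite inE vA.
Qed.

Lemma max_intersecting_in_star (G : sgraph) (r : nat) (F : {set {set G}})
    (v : G) :
  max_intersecting r F -> (forall A, A \in F -> v \in A) ->
  star_size r v = #|F|.
Proof.
move=> Fmax vF; apply/eqP; rewrite eqn_leq star_size_le_max //=.
have [/subsetP sF _ _] := Fmax.
by apply/subset_leq_card/subsetP => A AF; rewrite inE sF ?vF.
Qed.

(** The pair count needs [r >= 2], so [r = 1] is separate: intersecting singletons coincide. If [F]
    is empty, any vertex serves. *)
Lemma EKR1 (G : sgraph) : 0 < #|G| -> EKR 1 G.
Proof.
move=> /card_gt0P[v _] F Fmax; have [sF Fint _] := Fmax.
have [F0|[A AF]] := set_0Vmem F.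
  by exists v; apply: max_intersecting_in_star => // A; rewrite F0 inE.
have := subsetP sF _ AF; rewrite inE => /andP[_ /cards1P[x Ax]].
exists x; apply: max_intersecting_in_star => // B BF.
by have /set0Pn[y /setIP[]] := Fint _ _ AF BF; rewrite Ax inE => /eqP ->.
Qed.

Lemma EKR_of_average (G : sgraph) (k : nat) : 0 < #|G| ->
  #|G| * (k.+2 ^ 2 * 'C(#|G|.-2, k)) <= k.+2 * #|indep_sets G k.+2| ->
  EKR k.+2 G.
Proof.
move=> G0 avg F Fmax; have [/subsetP sF Fint _] := Fmax.
case: (boolP [exists x, forall A in F, x \in A]) => [/existsP[x]|].
  by move=> /forall_inP xF; exists x; apply: max_intersecting_in_star.
move=> /existsPn nonstar.
have Fle : #|F| <= k.+2 ^ 2 * 'C(#|G|.-2, k).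
  apply: leq_card_intersecting_nonstar => // [A /sF|x].
    by rewrite inE => /andP[_ /eqP].
  by have /forall_inPn[B BF xB] := nonstar x; exists B.
case: (boolP [exists v : G, #|F| <= star_size k.+2 v]) => [/existsP[v Fv]|].
  by exists v; apply/eqP; rewrite eqn_leq Fv star_size_le_max.
move=> /existsPn small.
(* If every star is smaller than [F], each vertex loses at least one, [#|G|] in total, while [avg]
   and [Fle] leave no room for a loss. *)
have sum_lt : \sum_(v : G) star_size k.+2 v + #|G| <= #|G| * #|F|.
  rewrite -[X in _ + X]sum1_card -big_split /= -sum_nat_const leq_sum // => v _.
  by rewrite addn1 ltnNge small.
have : #|G| * #|F| + #|G| <= #|G| * #|F|.
  apply: leq_trans sum_lt; rewrite leq_add2r sum_star_size.
  by apply: leq_trans avg; rewrite leq_mul2l Fle orbT.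
by rewrite -[X in _ <= X]addn0 leq_add2l leqNgt G0.
Qed.

Local Open Scope ring_scope.

Lemma average_bound (R : realFieldType) (n r c m D C I : R) :
    2 <= r -> 1 <= 18 * c -> 18 * c * r ^+ 3 < n -> m <= c * n -> 0 <= D ->
    n * (n - 1) * D = r * (r - 1) * C -> C <= I + m * D ->
  n * (r ^+ 2 * D) <= r * I.
Proof.
move=> r2 c18 n_gt mcn D0 nD CI.
have r1 : 0 < r - 1 by lra.
have rr1 : 0 <= r * (r - 1) by nra.
have n0 : 0 <= n.
  by apply: le_trans (ltW n_gt); rewrite mulr_ge0 ?exprn_ge0 //; lra.
(* Multiplied by [n * D], this absorbs both the target [r ^+ 2] and the edge term [m * D], after
   scaling by [r * (r - 1)] and [r - 1]. *)
have n_ge : r ^+ 2 * (r - 1) + r * (r - 1) * c <= n - 1.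
  have r_sq : 2 * r <= r ^+ 2 by nra.
  have r_cube : 2 * r ^+ 2 <= r ^+ 3.
    by rewrite [r ^+ 3]exprS ler_wpM2r ?exprn_ge0 //; lra.
  (* The expression [18 * c * r ^+ 3 - r * (r - 1) * c] is linear in [c] with slope
     [18 * r ^+ 3 - r ^+ 2 + r]; [d0] reduces the bound to [c = 1/18]. *)
  have d0 : 0 <= (18 * c - 1) * (18 * r ^+ 3 - r ^+ 2 + r).
    by rewrite mulr_ge0 //; lra.
  nra.
have H1 := ler_wpM2l rr1 CI.
have H2 := ler_wpM2l rr1 (ler_wpM2r D0 mcn).
have H3 := ler_wpM2l (mulr_ge0 n0 D0) n_ge.
rewrite -(ler_pM2l r1); nra.
Qed.

Theorem theorem2p2 (R : realType) (r : nat) (c : R) (G : sgraph) :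
  (0 < r)%N ->
  expR 1 / 36%:R <= c ->
  18%:R * c * r%:R ^+ 3 < #|G|%:R ->
  #|edges G|%:R <= c * #|G|%:R ->
  EKR r G.
Proof.
move=> r0 c_ge n_gt m_le.
(* From [1 + 1 <= expR 1] follows [c >= 2/36]. *)
have c18 : 1 <= 18 * c by have := @expR_ge1Dx R 1; lra.
have G0 : (0 < #|G|)%N.
  rewrite -(ltr0n R); apply: le_lt_trans n_gt.
  by rewrite mulr_ge0 ?exprn_ge0 //; lra.
case: r r0 n_gt => [//|[|k]] _ n_gt; first exact: EKR1.
apply: EKR_of_average => //; rewrite -(ler_nat R) !natrM -expr2.
apply: (@average_bound _ _ _ c #|edges G|%:R _ ('C(#|G|, k.+2)%:R)) => //.
- by rewrite ler_nat.
(* The truncated predecessor agrees with subtraction in [R] only for positive [i]; for [#|G|] this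
   is [G0]. *)
- have predE i : (0 < i)%N -> i%:R - 1 = i.-1%:R :> R.
    by move=> i0; rewrite -subn1 natrB.
  by rewrite !predE // -!natrM bin_pair.
- by rewrite -natrM -natrD ler_nat card_indep_sets_ge.
Qed.
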